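(* Let $\alpha\in\mathbb{T}\setminus\mathbb{Q}$. For all $(x,y)\in\mathbb{T}^2$, for almost every $h\in C(\mathbb{T},\mathbb{R})$, (I) the point $(x,y)$ exhibits the dense simultaneous approximation property in the system $(\mathbb{T}^2,T_h)$, and (II) for all non-empty, open $U\subseteq\mathbb{T}^2$, the return-time set $R((x,y),U)$ (in the system $(\mathbb{T}^2,T_h)$) is multiplicatively thick in a congruence subsemigroup.
   Context: $\mathbb{N}=\{1,2,\ldots\}$; $\mathbb{T}=\mathbb{R}/\mathbb{Z}$, and $\alpha\in\mathbb{T}\setminus\mathbb{Q}$ means $\alpha$ is the class of an irrational number. $C(\mathbb{T},\mathbb{R})$ is the space of continuous functions $\mathbb{T}\to\mathbb{R}$ with the uniform norm. ''For almost every $h$'' means for all $h$ in a residual set, i.e. a set containing a dense $G_\delta$ subset. For $h\in C(\mathbb{T},\mathbb{R})$, $T_h:\mathbb{T}^2\to\mathbb{T}^2$ is the homeomorphism $T_h(x,y)=(x+\alpha,\,y+\pi(h(x)))$, where $\pi:\mathbb{R}\to\mathbb{T}$ is the quotient map. $\mathbb{T}^2$ carries the maximum metric. For an invertible system $(X,T)$ (compact metric space with a homeomorphism), $x\in X$ and $A\subseteq\mathbb{Z}$, define $\mathrm{SA}(x,A)=\{y\in X : \forall\text{ finite }F\subseteq A,\ \forall\varepsilon>0,\ \exists m\in\mathbb{N},\ \forall f\in F,\ d_X(T^{fm}x,y)<\varepsilon\}$. A point $x$ possesses (exhibits) the dense simultaneous approximation property if for all $\delta>0$ there exists $N\in\mathbb{N}$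 such that for all $n\in\mathbb{Z}$ coprime to $N$, the set $\mathrm{SA}(x,N\mathbb{Z}+n)$ is $\delta$-dense in $X$ (meets every open ball of radius $\delta$). $R(x,U)=\{m\in\mathbb{Z} : T^mx\in U\}$. For $N\in\mathbb{N}$ the congruence subsemigroup $\mathbb{Z}_{N,1}$ of $(\mathbb{Z}\setminus\{0\},\cdot)$ is $\{n\in\mathbb{Z} : n\equiv1\pmod N\}$. A set $A\subseteq\mathbb{Z}$ is multiplicatively thick in a congruence subsemigroup if there exists $N\in\mathbb{N}$ such that for all finite $F\subseteq\mathbb{Z}_{N,1}$ there exists $m\in\mathbb{Z}_{N,1}$ with $mF=\{mf : f\in F\}\subseteq A$. *)

(* Defs.v *)
From HB Require Import structures.
From mathcomp Require Import all_boot all_order all_algebra.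
From mathcomp Require Import all_classical all_reals all_analysis.
From mathcomp Require Import borel_hierarchy.

Set Implicit Arguments.
Unset Strict Implicit.
Unset Printing Implicit Defensive.

Import Order.TTheory GRing.Theory Num.Theory.
Import numFieldNormedType.Exports.
(* Puts on [continuousType U V] the topology of uniform convergence. *)
Export ArrowAsUniformType.

Local Open Scope classical_set_scope.
Local Open Scope ring_scope.

Section circle.
Variable R : realType.
Local Open Scope quotient_scope.

Definition integers : zmodClosed R :=
  GRing.ZmodClosed.clone R (@Num.int_num_subdef R) _.

Definition circle : Type := Quotient.quot integers.
HB.instance Definition _ := GRing.Zmodule.on circle.

Definition proj_circle (a : R) : circle := \pi_(Quotient.quot integers) a.

Lemma proj_circle_surj (x : circle) : exists a, proj_circle a = x.
Proof. by exists (repr (x : Quotient.quot integers)); exact: reprK. Qed.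

Lemma proj_circle_eq (a b : R) :
  proj_circle a = proj_circle b <-> a - b \is a Num.int.
Proof.
have -> : (a - b \is a Num.int) = (a - b \in integers) by [].
rewrite Quotient.idealrBE; split=> [e|/eqP//]; exact/eqP.
Qed.

Lemma proj_circle_is_zmod_morphism : zmod_morphism proj_circle.
Proof. by move=> a b; rewrite /proj_circle raddfB. Qed.

HB.instance Definition _ :=
  GRing.isZmodMorphism.Build R circle proj_circle proj_circle_is_zmod_morphism.

(* The distance from a representative of [x] to the nearest integer. *)
Definition circle_norm (x : circle) : R :=
  inf [set `|a| | a in [set a | proj_circle a = x]].

Let reps_has_inf (x : circle) :
  has_inf [set `|a| | a in [set a | proj_circle a = x]].
Proof.
split; last by exists 0 => _ [a _ <-].
by have [a ax] := proj_circle_surj x; exists `|a|; exists a.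
Qed.

Lemma circle_norm_le (a : R) : circle_norm (proj_circle a) <= `|a|.
Proof. by apply: ge_inf; [exact: (reps_has_inf _).2|exists a]. Qed.

Lemma circle_norm_lt (x : circle) (e : R) :
  circle_norm x < e -> exists2 a, proj_circle a = x & `|a| < e.
Proof.
by move=> /inf_lt-/(_ (reps_has_inf x).1)[_ [a ax <-] ae]; exists a.
Qed.

Lemma circle_norm_ge0 (x : circle) : 0 <= circle_norm x.
Proof. by apply: lb_le_inf; [exact: (reps_has_inf x).1|move=> _ [a _ <-]]. Qed.

Lemma circle_norm0 : circle_norm 0 = 0.
Proof.
apply/eqP; rewrite eq_le circle_norm_ge0 andbT.
by have := circle_norm_le 0; rewrite raddf0 normr0.
Qed.

Lemma circle_normN (x : circle) : circle_norm (- x) = circle_norm x.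
Proof.
congr inf; apply/seteqP; split=> _ [a /= ax <-]; exists (- a) => /=;
  by rewrite ?normrN// raddfN /= ax ?opprK.
Qed.

Lemma circle_normD (x y : circle) :
  circle_norm (x + y) <= circle_norm x + circle_norm y.
Proof.
apply/ler_addgt0Pl => e e0; have e20 : 0 < e / 2 by rewrite divr_gt0.
have /circle_norm_lt[a <- /ltW ae] : circle_norm x < circle_norm x + e / 2.
  by rewrite ltrDl.
have /circle_norm_lt[b <- /ltW be] : circle_norm y < circle_norm y + e / 2.
  by rewrite ltrDl.
rewrite -raddfD (le_trans (circle_norm_le _))// (le_trans (ler_normD _ _))//.
by rewrite (le_trans (lerD ae be))// addrACA -splitr addrC.
Qed.

Lemma circle_norm_eq0 (x : circle) : circle_norm x = 0 -> x = 0.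
Proof.
move=> x0; have /circle_norm_lt[a ax a1] : circle_norm x < 2^-1.
  by rewrite x0 invr_gt0.
have [a0|a0] := eqVneq a 0; first by rewrite -ax a0 raddf0.
have : circle_norm x < `|a| by rewrite x0 normr_gt0.
move=> /circle_norm_lt[b bx ba].
have /proj_circle_eq abint : proj_circle a = proj_circle b by rewrite ax bx.
have ab : a - b = 0.
  apply/eqP/contraT => ab0; have := norm_intr_ge1 abint ab0.
  rewrite leNgt (le_lt_trans (ler_normB _ _))// [ltRHS]splitr mul1r.
  by rewrite ltrD// (lt_trans ba).
by move: ba; rewrite (subr0_eq ab) ltxx.
Qed.

Definition circle_dist (x y : circle) : R := circle_norm (x - y).

Lemma circle_distxx (x : circle) : circle_dist x x = 0.
Proof. by rewrite /circle_dist subrr circle_norm0. Qed.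

Lemma circle_dist_eq0 (x y : circle) : circle_dist x y = 0 -> x = y.
Proof. by move=> /circle_norm_eq0/subr0_eq. Qed.

Lemma circle_dist_sym (x y : circle) : circle_dist x y = circle_dist y x.
Proof. by rewrite /circle_dist -circle_normN opprB. Qed.

Lemma circle_dist_triangle (y x z : circle) :
  circle_dist x z <= circle_dist x y + circle_dist y z.
Proof. by rewrite /circle_dist -[x](subrK y) -addrA subrK circle_normD. Qed.

HB.instance Definition _ := isMetric.Build R circle
  circle_distxx circle_dist_eq0 circle_dist_sym circle_dist_triangle.

End circle.

Section product_metric.
Context {R : realType} {U V : metricType R}.

Let dist (x y : U * V) : R :=
  Order.max (mdist x.1 y.1 : R) (mdist x.2 y.2).

Let dist_ge0 x y : 0 <= dist x y.
Proof. by rewrite le_max mdist_ge0. Qed.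

Let dist_positivity x y : dist x y = 0 -> x = y.
Proof.
move=> xy; have := lexx (dist x y); rewrite {2}xy ge_max => /andP[xy1 xy2].
case: x y xy1 xy2 {xy} => [x1 x2] [y1 y2] /= xy1 xy2.
by congr pair; apply: (@mdist_positivity R); apply/eqP; rewrite eq_le mdist_ge0 andbT.
Qed.

Let ballEdist x d : ball x d = [set y | dist x y < d].
Proof.
rewrite /ball/= /prod_ball !ballEmdist; apply/seteqP.
by split=> y; rewrite /= /dist gt_max => /andP.
Qed.

HB.instance Definition _ := @PseudoMetric_isMetric.Build R (U * V)%type
  dist dist_ge0 dist_positivity ballEdist.

End product_metric.

Section torus.
Variable R : realType.
Local Notation T := (circle R).

Lemma proj_circle_continuous : continuous (@proj_circle R).
Proof.
move=> a; apply/(@cvg_ballP R) => e e0.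
apply: filterS (nbhsx_ballx a e e0) => b ab.
rewrite ballEmdist/= /mdist/= /circle_dist -raddfB.
exact: le_lt_trans (circle_norm_le _) ab.
Qed.

Lemma circle_add_continuous : continuous (fun p : T * T => p.1 + p.2).
Proof.
move=> [x y]; apply/(@cvg_ballP R) => e e0.
have e20 : 0 < e / 2 by rewrite divr_gt0.
apply: filterS (nbhsx_ballx (x, y) (e / 2) e20) => -[x' y'] [/=].
rewrite !ballEmdist/= /mdist/= /circle_dist => xx' yy'.
rewrite opprD addrACA (le_lt_trans (circle_normD _ _))//.
by rewrite [ltRHS]splitr ltrD.
Qed.

Lemma circle_compact : compact [set: T].
Proof.
have -> : [set: T] = @proj_circle R @` `[0, 1].
  apply/seteqP; split=> // x _; have [a <-] := proj_circle_surj x.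
  exists (a - (Num.floor a)%:~R) => /=.
    rewrite in_itv/= subr_ge0 lerBlDl; have /andP[-> /ltW] := floor_itv a.
    by rewrite intrD.
  by apply/proj_circle_eq; rewrite addrAC subrr add0r rpredN intr_int.
apply: continuous_compact; last exact: segment_compact.
exact/continuous_subspaceT/proj_circle_continuous.
Qed.

Lemma torus_compact : compact [set: T * T].
Proof.
have -> : [set: T * T] = [set: T] `*` [set: T] by apply/seteqP; split.
by apply: compact_setX; exact: circle_compact.
Qed.

End torus.

Record homeo (X : topologicalType) := Homeo {
  hfun :> X -> X;
  hinv : X -> X;
  hfunK : cancel hfun hinv;
  hinvK : cancel hinv hfun;
  hfun_continuous : continuous hfun;
  hinv_continuous : continuous hinv
}.

(* [ziter T m] is the m-th power of T, with [Negz n] standing for -(n+1). *)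
Definition ziter (X : topologicalType) (T : homeo X) (m : int) : X -> X :=
  match m with
  | Posz n => iter n T
  | Negz n => iter n.+1 (hinv T)
  end.

Section dynamics.
Context {R : realType} {X : metricType R}.
Implicit Types (T : homeo X) (x : X).

Definition SA T x (A : set int) : set X :=
  [set y | forall F : set int, finite_set F -> F `<=` A ->
    forall e : R, 0 < e ->
    exists2 m : nat, (0 < m)%N &
      forall f, F f -> mdist (ziter T (f * m%:Z) x) y < e].

Definition delta_dense (delta : R) (S : set X) : Prop :=
  forall z : X, exists2 y, S y & mdist z y < delta.

Definition dense_simultaneous_approximation T x : Prop :=
  forall delta : R, 0 < delta ->
  exists2 N : nat, (0 < N)%N &
    forall n : int, coprimez n N%:Z ->
      delta_dense delta (SA T x [set N%:Z * k + n | k in [set: int]]).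

Definition return_times T x (U : set X) : set int :=
  [set m | U (ziter T m x)].

End dynamics.

(* A multiplicative subsemigroup of Z \ {0}: the condition [n != 0] excludes 0 when N = 1
   and follows from the congruence when N >= 2. *)
Definition congruence_subsemigroup (N : nat) : set int :=
  [set n | n != 0 /\ (n = 1 %[mod N%:Z])%Z].

Definition mult_thick_in_congruence_subsemigroup (A : set int) : Prop :=
  exists2 N : nat, (0 < N)%N &
    forall F : set int, finite_set F -> F `<=` congruence_subsemigroup N ->
    exists2 m : int, congruence_subsemigroup N m &
      [set m * f | f in F] `<=` A.

Definition residual (X : topologicalType) (A : set X) : Prop :=
  exists G : set X, [/\ Gdelta G, dense G & G `<=` A].

Definition irrational_class (R : realType) (alpha : circle R) : Prop :=
  exists2 a : R, irrational a & proj_circle a = alpha.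

Section skew_product.
Context {R : realType}.
Local Notation T := (circle R).

(* The topology on C(T, R) is the one of the uniform norm. *)
Lemma nbhs_uniform_norm (h : continuousType T R)
    (A : set (continuousType T R)) :
  nbhs h A <-> exists2 e : R, 0 < e &
    [set g : continuousType T R | forall t, `|h t - g t| < e] `<=` A.
Proof.
rewrite -nbhs_entourageE; split=> [[E [D entD DE] EA]|[e e0 eA]].
  move: entD; rewrite -(@entourage_ballE R) => -[e e0 eD]; exists e => // g hg.
  by apply/EA/xsectionP/DE/eD => t; exact: hg.
exists [set hg : continuousType T R * continuousType T R |
    forall t, `|hg.1 t - hg.2 t| < e]; last first.
  by move=> g /xsectionP hg; exact: eA.
exists [set fg : (T -> R) * (T -> R) | forall t, `|fg.1 t - fg.2 t| < e] => //.
by rewrite -(@entourage_ballE R); exists e.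
Qed.

Variables (alpha : T) (h : continuousType T R).

Definition skew_fun (p : T * T) : T * T :=
  (p.1 + alpha, p.2 + proj_circle (h p.1)).

Definition skew_inv (p : T * T) : T * T :=
  (p.1 - alpha, p.2 - proj_circle (h (p.1 - alpha))).

Lemma skew_funK : cancel skew_fun skew_inv.
Proof. by case=> x y; rewrite /skew_fun/skew_inv/= !addrK. Qed.

Lemma skew_invK : cancel skew_inv skew_fun.
Proof. by case=> x y; rewrite /skew_fun/skew_inv/= !subrK. Qed.

Let add_continuous (S : topologicalType) (f g : S -> T) :
  continuous f -> continuous g -> continuous (fun s => f s + g s).
Proof.
move=> cf cg s; apply: (continuous_comp (f := fun s => (f s, g s))
  (g := fun p : T * T => p.1 + p.2)); last exact: circle_add_continuous.
exact: (cvg_pair (cf s) (cg s)).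
Qed.

Let c1 : continuous (@fst T T). Proof. by move=> p; exact: cvg_fst. Qed.
Let c2 : continuous (@snd T T). Proof. by move=> p; exact: cvg_snd. Qed.

Lemma skew_fun_continuous : continuous skew_fun.
Proof.
have k1 : continuous (fun p : T * T => p.1 + alpha).
  by apply: add_continuous c1 _ => p; exact: cvg_cst.
have k2 : continuous (fun p : T * T => p.2 + proj_circle (h p.1)).
  apply: add_continuous c2 _ => p.
  apply: (continuous_comp (f := fun p : T * T => h p.1) (g := @proj_circle R));
    last exact: proj_circle_continuous.
  by apply: continuous_comp; [exact: c1|exact: cts_fun].
by move=> p; exact: (cvg_pair (k1 p) (k2 p)).
Qed.

Lemma skew_inv_continuous : continuous skew_inv.
Proof.
have k1 : continuous (fun p : T * T => p.1 - alpha).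
  by apply: add_continuous c1 _ => p; exact: cvg_cst.
have k2 : continuous (fun p : T * T => p.2 - proj_circle (h (p.1 - alpha))).
  rewrite (_ : (fun p => _) = fun p : T * T =>
    p.2 + proj_circle (- h (p.1 - alpha))); last first.
    by apply/funext => p; rewrite raddfN.
  apply: add_continuous c2 _ => p.
  apply: (continuous_comp (f := fun p : T * T => - h (p.1 - alpha))
    (g := @proj_circle R)); last exact: proj_circle_continuous.
  by apply: cvgN; exact: (continuous_comp (k1 p) (@cts_fun _ _ h _)).
by move=> p; exact: (cvg_pair (k1 p) (k2 p)).
Qed.

Definition skew_homeo : homeo (T * T)%type :=
  Homeo skew_funK skew_invK skew_fun_continuous skew_inv_continuous.

End skew_product.

(* Main.v *)
Require Import Defs.
From mathcomp Require Import all_boot all_order all_algebra.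
From mathcomp Require Import all_classical all_reals all_analysis.
From mathcomp Require Import zify lra ring.

Set Implicit Arguments.
Unset Strict Implicit.
Unset Printing Implicit Defensive.

Import Order.TTheory GRing.Theory Num.Theory.
Import numFieldNormedType.Exports.
Local Open Scope classical_set_scope.
Local Open Scope ring_scope.

(** Both conclusions follow from one approximation property of the orbit of
    [(x, y)].  Given [N], integers [k] and a rational [q], a finite set [F] of
    non-zero integers and [e > 0], ask for one time [m >= 1] with
    [m = 1 mod N] such that, for all [f] in [F] at once, the point
    [T_h^(f m) (x, y)] is [e]-close to [(x + f k / N, y + q)].  The second
    coordinate of the target does not depend on [f], and the first one only on
    [f] mod [N]; so when [F] lies in a residue class [n] mod [N] all its
    elements are sent close to the same point [(x + n k / N, y + q)]
    ([steerable_congr]).  If [n] is coprime to [N], then [n k / N] runs over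
    all multiples of [1 / N]; letting [N > 1 / delta] gives the dense
    simultaneous approximation property, and [n = 1] gives the
    multiplicative thickness of the return times.

    It remains to see that the property is generic in [h].  There are
    countably many data [(N, k, q, F, e)] with [e] of the form [1 / (j + 1)],
    and for each of them the set of good [h] is
    - open, because a fixed iterate of [T_h] depends on [h] in a Lipschitz way
      ([open_ziter_near]);
    - dense ([dense_simultaneous_hits]).  By Kronecker's theorem there are
      arbitrarily large [m = 1 mod N] with [m alpha] close to [k / N], which
      takes care of the first coordinates.  The second coordinate of
      [T_h^n (x, y)] is [y] plus a Birkhoff sum of [h] along the orbit of [x].
      Between two consecutive multiples of [m] this sum has [m] terms, so that
      changing each of them by less than [1 / m] moves it to any prescribed
      class mod 1.  The points [x + i alpha] are distinct, hence a continuous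
      perturbation of uniform norm at most [1 / m] realizes all these changes
      together ([steer]).
    Baire's theorem in the space of continuous functions
    ([baire_continuous]) concludes. *)

(** * Multiples of a point of the circle *)

Section circle_arithmetic.
Context {R : realType}.
Local Notation T := (circle R).
Implicit Types (t x : T) (a : R).

Lemma proj_circle_int (z : int) : proj_circle z%:~R = 0 :> T.
Proof.
rewrite -[RHS](raddf0 (@proj_circle R)); apply/proj_circle_eq.
by rewrite subr0 intr_int.
Qed.

Lemma circle_repr01 t : exists a, proj_circle a = t /\ 0 <= a < 1.
Proof.
have [a <-] := proj_circle_surj t; exists (a - (Num.floor a)%:~R); split.
  by rewrite raddfB /= proj_circle_int subr0.
have /andP[h1 h2] := floor_itv a; rewrite intrD in h2.
by rewrite subr_ge0 h1 ltrBlDl.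
Qed.

Lemma circle_normMn t n : circle_norm (t *+ n) <= circle_norm t *+ n.
Proof.
elim: n => [|n IH]; first by rewrite !mulr0n circle_norm0.
by rewrite !mulrS (le_trans (circle_normD _ _))// lerD2l.
Qed.

Lemma circle_normMz t (z : int) :
  circle_norm (t *~ z) <= circle_norm t *+ `|z|%N.
Proof.
case: z => n; first exact: circle_normMn.
by rewrite NegzE mulrNz circle_normN; exact: circle_normMn.
Qed.

Definition aperiodic t := forall n, (0 < n)%N -> t *+ n != 0.

(** Dirichlet's pigeonhole: two of the first [M + 1] multiples fall into the
    same of the [M] arcs of length [1 / M]. *)
Lemma circle_small_multiple t (e : R) : 0 < e ->
  exists2 n : nat, (0 < n)%N & circle_norm (t *+ n) < e.
Proof.
move=> e0.
have [a aE] := choice (fun i : nat => circle_repr01 (t *+ i)).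
pose M := (Num.truncn e^-1).+1.
have Me : M%:R^-1 < e by rewrite invf_plt ?posrE// truncnS_gt.
pose f i := Num.truncn (M%:R * a i).
have fM i : M%:R * a i >= 0.
  by have [_ /andP[? _]] := aE i; rewrite mulr_ge0.
apply: contrapT => no.
suff : (M.+1 <= M)%N by rewrite ltnn.
apply: (@pigeonhole _ _ f); last first.
  move=> _ [i _ <-] /=; rewrite truncn_lt_nat//.
  by have [_ /andP[_ ?]] := aE i; rewrite gtr_pMr.
have key i j : (i < j)%N -> f i = f j -> False.
  move=> ij fij; apply: no; exists (j - i)%N; first by rewrite subn_gt0.
  rewrite mulrnBr 1?ltnW// -(aE i).1 -(aE j).1 -raddfB.
  apply: le_lt_trans (circle_norm_le _) _; apply: lt_trans Me.
  rewrite -[ltRHS]mul1r ltr_pdivlMr// -[X in _ * X]ger0_norm// -normrM mulrBl.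
  have := truncn_itv (fM i); have := truncn_itv (fM j).
  rewrite -!/(f _) fij !mulrSr ltr_norml ![a _ * _]mulrC; lra.
move=> i j _ _ fij; apply/eqP; case: (ltngtP i j) => // ij; exfalso.
  exact: key fij.
exact: key (esym fij).
Qed.

(** The multiples of a small non-zero multiple of [t] advance around the circle
    by steps shorter than [e], and may be followed for as many turns as
    wanted. *)
Lemma kronecker t : aperiodic t ->
  forall (s : T) (e : R) (L : nat), 0 < e ->
  exists2 n : nat, (L <= n)%N & circle_norm (t *+ n - s) < e.
Proof.
move=> tn0 s e L e0.
have [d d0 /circle_norm_lt[c ctd ce]] := circle_small_multiple t e0.
have c0 : c != 0.
  by apply: contra_neq (tn0 d d0) => c0; rewrite -ctd c0 raddf0.
(* Walking by [c] in its own direction reduces to positive steps [`|c|]. *)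
pose sg : int := if 0 < c then 1 else -1.
have cE : c = `|c| * sg%:~R.
  rewrite /sg; case: (ltgtP 0 c) c0 => // c0 _.
    by rewrite gtr0_norm ?mulr1.
  by rewrite ltr0_norm// mulrN1 opprK.
have sg2 : sg%:~R * sg%:~R = 1 :> R.
  by rewrite /sg; case: ifP; rewrite ?mulr1 ?mulN1r ?opprK.
have c_gt0 : 0 < `|c| by rewrite normr_gt0.
have [b bs] := proj_circle_surj s.
(* The integer [z] makes [b + sg * z], which still represents [s], lie at least
   [L] steps away from 0 on the side of [c]. *)
pose z := Num.ceil (`|c| * L%:R - sg%:~R * b).
pose r := sg%:~R * b + z%:~R.
have rL : `|c| * L%:R <= r by rewrite -lerBlDl Num.Theory.ceil_ge.
have rc : L%:R <= r / `|c| by rewrite ler_pdivlMr// mulrC.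
have rc0 : 0 <= r / `|c| by exact: le_trans rc.
pose k := Num.truncn (r / `|c|).
have Lk : (L <= k)%N by rewrite truncn_ge_nat.
exists (d * k)%N; first by rewrite (leq_trans Lk)// leq_pmull.
have -> : t *+ (d * k) - s = proj_circle (c *+ k - b - (sg * z)%:~R).
  by rewrite raddfB /= proj_circle_int subr0 raddfB raddfMn /= ctd bs mulrnA.
apply: le_lt_trans (circle_norm_le _) _; apply: le_lt_trans ce.
have -> : c *+ k - b - (sg * z)%:~R = sg%:~R * (`|c| * k%:R - r).
  rewrite {1}cE /r intrM mulrBr mulrDr [_ * (_ * b)]mulrA sg2 -mulr_natr; ring.
have -> : `|sg%:~R * (`|c| * k%:R - r)| = `| `|c| * k%:R - r|.
  by rewrite /sg; case: ifP => _; rewrite ?mul1r// mulN1r normrN.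
have /andP[] := truncn_itv rc0; rewrite -/k ler_pdivlMr// ltr_pdivrMr// mulrSr.
by rewrite ler_norml; nra.
Qed.

Lemma irrational_class_aperiodic t : irrational_class t -> aperiodic t.
Proof.
move=> [a irr <-] n n0; apply/eqP.
rewrite -raddfMn -[0](raddf0 (@proj_circle R)).
move=> /proj_circle_eq; rewrite subr0 => /intrP[z az]; apply: irr.
exists (z%:Q / n%:Q) => //.
rewrite fmorph_div /= ratr_int !ratr_int -az -[a *+ n]mulr_natr mulfK//.
by rewrite pnatr_eq0 -lt0n.
Qed.

(** Kronecker's theorem for the multiple [t *+ N] and the target [s - t]. *)
Lemma kronecker_congr t (N : nat) : (0 < N)%N -> aperiodic t ->
  forall (s : T) (e : R) (L : nat), 0 < e ->
  exists m : nat,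
    [/\ (L < m)%N, (m = 1 %[mod N])%N & circle_norm (t *+ m - s) < e].
Proof.
move=> N0 tn0 s e L e0.
have tNn : aperiodic (t *+ N).
  by move=> n n0; rewrite -mulrnA tn0// muln_gt0 N0.
have [n Ln ne] := kronecker tNn (s - t) L e0.
exists (N * n + 1)%N; split.
- by rewrite addn1 ltnS (leq_trans Ln)// leq_pmull.
- by rewrite mulnC modnMDl.
- by move: ne; rewrite mulrnDr mulr1n mulrnA opprB addrA -addrA.
Qed.

End circle_arithmetic.

(** * Interpolation by continuous functions of small uniform norm *)

Section interpolation.
Context {R : realType} {X : metricType R}.

Lemma mdist_continuousl (b : X) : continuous (fun t => mdist t b : R).
Proof.
move=> t; apply/(@cvg_ballP R) => e e0.
apply: filterS (nbhsx_ballx t e e0) => u; rewrite ballEmdist /= => tu.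
have h1 := metric_triangle u t b; have h2 := metric_triangle t u b.
rewrite (metric_sym u t) in h1; rewrite /ball /= ltr_norml; lra.
Qed.

(** A product of normalized distances, as in Lagrange interpolation. *)
Lemma lagrange_bump (I : eqType) (a : I -> X) (i : I) (s : seq I) :
  injective a -> i \notin s ->
  exists p : X -> R,
    [/\ continuous p, p (a i) = 1 & {in s, forall j, p (a j) = 0}].
Proof.
move=> inj_a; elim: s => [_|j s IH].
  by exists (cst 1); split=> // t; exact: cvg_cst.
rewrite inE negb_or => /andP[ij /IH[p [cp p1 p0]]].
have aij : mdist (a i) (a j) != 0 :> R.
  by apply: contra_neq ij => /mdist_positivity /inj_a.
exists (fun t => p t * (mdist t (a j) / mdist (a i) (a j))); split.
- move=> t; apply: cvgM; first exact: cp.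
  by apply: cvgM; [exact: mdist_continuousl|exact: cvg_cst].
- by rewrite p1 mul1r divff.
- move=> k; rewrite inE => /orP[/eqP ->|/p0 ->]; last by rewrite mul0r.
  by rewrite mdistxx mul0r mulr0.
Qed.

(** Truncating at [-B] and [B] an unbounded interpolant does not change its
    values on the nodes. *)
Lemma bounded_interpolation (I : eqType) (a : I -> X) (c : I -> R) (B : R)
    (s : seq I) :
  injective a -> 0 <= B -> (forall i, `|c i| <= B) ->
  exists p : X -> R, [/\ continuous p, forall t, `|p t| <= B
    & {in s, forall i, p (a i) = c i}].
Proof.
move=> inj_a B0 cB.
have [p [cp pc]] : exists p : X -> R,
    continuous p /\ {in s, forall i, p (a i) = c i}.
  elim: s => [|i s [p [cp pc]]].
    by exists (cst 0); split=> // t; exact: cvg_cst.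
  have [si|si] := boolP (i \in s).
    by exists p; split=> // j; rewrite inE => /orP[/eqP ->|]; exact: pc.
  have [q [cq q1 q0]] := lagrange_bump inj_a si.
  exists (fun t => p t + (c i - p (a i)) * q t); split.
    move=> t; apply: cvgD; first exact: cp.
    by apply: cvgM; [exact: cvg_cst|exact: cq].
  move=> j; rewrite inE => /orP[/eqP ->|js].
    by rewrite q1 mulr1 addrC subrK.
  by rewrite q0// mulr0 addr0 pc.
exists (fun t => Num.max (- B) (Num.min B (p t))); split.
- move=> t; apply: (@continuous_max R X (cst (- B)) (fun t => Num.min B (p t))).
    exact: cvg_cst.
  by apply: (@continuous_min R X (cst B) p); [exact: cvg_cst|exact: cp].
- by move=> t; rewrite ler_norml le_max lexx ge_max ge_min lexx/= andbT ge0_cp.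
- move=> i /pc ->; have := cB i; rewrite ler_norml => /andP[h1 h2].
  by rewrite (min_idPr h2) (max_idPr h1).
Qed.

End interpolation.

(** * Baire's theorem for continuous functions on the circle *)

Section baire.
Context {R : realType}.
Local Notation T := (circle R).
Local Notation C := (continuousType T R).

(** The classical nested balls.  Their centers converge uniformly, so the limit
    is continuous and lies in every ball. *)
Lemma baire_continuous (F : nat -> set C) :
  (forall i, open (F i)) -> (forall i, dense (F i)) -> dense (\bigcap_i F i).
Proof.
move=> oF dF O O0 oO.
(* A ball defined by pointwise strict inequalities need not be open in the
   uniform topology, whence closed balls and interiors below. *)
pose B (g : C) (r : R) : set C := [set k | forall t, `|g t - k t| <= r].
have inside (V : set C) h : open V -> V h ->
    exists2 e : R, 0 < e & B h e `<=` V.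
  move=> oV Vh.
  have /nbhs_uniform_norm[e e0 eV] : nbhs h V by apply/open_nbhs_nbhs.
  exists (e / 2); first by rewrite divr_gt0.
  move=> g hg; apply: eV => t; apply: le_lt_trans (hg t) _.
  by rewrite ltr_pdivrMr// ltr_pMr// ltr1n.
(* One step of the construction: from the ball [hr] to a ball [ks] inside it. *)
pose good (n : nat) (hr ks : C * R) := 0 < hr.2 ->
  [/\ 0 < ks.2, ks.2 <= n.+1%:R^-1, B ks.1 ks.2 `<=` B hr.1 hr.2
    & B ks.1 ks.2 `<=` F n].
have step (nhr : nat * (C * R)) : exists ks, good nhr.1 nhr.2 ks.
  case: nhr => n [h r] /=; have [r0|r0] := ltP 0 r; last first.
    by exists (h, r); rewrite /good /= ltNge r0.
  have nbV : nbhs h (B h (r / 2)).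
    apply/nbhs_uniform_norm; exists (r / 2); first by rewrite divr_gt0.
    by move=> g hg t; exact/ltW/hg.
  have [k [kV kF]] : ((B h (r / 2))° `&` F n) !=set0.
    by apply: dF; [exists h|exact: open_interior].
  have [e e0 eF] := inside _ _ (oF n) kF.
  have {}kV := interior_subset kV.
  exists (k, Num.min (Num.min e (r / 2)) n.+1%:R^-1) => _ /=; split.
  - by rewrite !lt_min e0 invr_gt0 ltr0Sn divr_gt0.
  - by rewrite ge_min lexx orbT.
  - move=> g kg t; rewrite (le_trans (ler_distD (k t) _ _))// [leRHS]splitr.
    rewrite lerD//.
    by rewrite (le_trans (kg t))// !ge_min lexx !orbT.
  - by move=> g kg; apply: eF => t; rewrite (le_trans (kg t))// !ge_min lexx.
have [f fP] := choice step.
have [h0 O_h0] := O0.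
have [r0 r0_gt0 r0O] := inside _ _ oO O_h0.
pose hr := fix hr n := if n is m.+1 then f (m, hr m) else (h0, r0).
have hr0 n : 0 < (hr n).2.
  by elim: n => [//|n IH] /=; have [] := fP (n, hr n) IH.
have hrP n : good n (hr n) (hr n.+1) by exact: fP (n, hr n).
have nest m n : (m <= n)%N -> B (hr n).1 (hr n).2 `<=` B (hr m).1 (hr m).2.
  move=> /subnK <-; elim: (n - m)%N => [//|d IH]; rewrite addSn.
  by have [_ _ + _] := hrP (d + m)%N (hr0 _); move/subset_trans; apply.
have center n : B (hr n).1 (hr n).2 (hr n).1.
  by move=> t; rewrite subrr normr0 ltW.
pose u (n : nat) : arrow_uniform_type T R := ((hr n).1 : T -> R).
have cvu : cvg (u @ \oo).
  apply: cauchy_cvg; apply: cauchy_exP => e e0.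
  have [n ne] : exists n : nat, n.+1%:R^-1 < e.
    by exists (Num.truncn e^-1); rewrite invf_plt ?posrE// truncnS_gt.
  exists (u n.+1), n.+1 => // m /= nm t.
  rewrite /ball /=; apply: le_lt_trans ne.
  apply: (@le_trans _ _ (hr n.+1).2); last by have [] := hrP n (hr0 n).
  exact: (nest _ _ nm _ (center m)).
pose l := lim (u @ \oo).
have lu (e : R) : 0 < e -> \forall n \near \oo, forall t, `|l t - u n t| < e.
  by move=> e0; have /(@cvg_ballP R)/(_ e e0) := cvu.
have cl : continuous l.
  apply: (@uniform_limit_continuous T R (u @ \oo) l).
    by near_simpl; apply: nearW => n; exact: cts_fun.
  by move=> ?; rewrite /= uniform_nbhsT; exact: cvu.
pose L : C := mkcts cl.
have BL n : B (hr n).1 (hr n).2 L.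
  move=> t; apply/ler_addgt0Pl => e e0.
  near \oo => m.
  have nm : (n <= m)%N by near: m; exact: nbhs_infty_ge.
  have : `|l t - u m t| < e by near: m; apply: filterS (lu e e0) => m; apply.
  move=> /ltW lm; rewrite (le_trans (ler_distD (u m t) _ _))// addrC lerD//.
    by rewrite distrC.
  exact: (nest _ _ nm _ (center m)).
exists L; split; first exact/r0O/(BL 0%N).
by move=> n _; have [_ _ _ ] := hrP n (hr0 n); apply; exact: BL.
Unshelve. all: by end_near. Qed.

End baire.

(** * Orbits of skew products *)

Lemma ziterS (X : topologicalType) (T : homeo X) (z : int) (p : X) :
  ziter T (z + 1) p = T (ziter T z p).
Proof.
case: z => [n|[|n]]; first by rewrite (_ : Posz n + 1 = Posz n.+1)//; lia.
  by rewrite /= hinvK.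
by rewrite (_ : Negz n.+1 + 1 = Negz n) /= ?hinvK//; lia.
Qed.

Section skew_orbits.
Context {R : realType}.
Local Notation T := (circle R).
Local Notation C := (continuousType T R).
Variable alpha : T.
Implicit Types (h g : C) (p : T * T) (z : int).

Lemma skew_ziter1 h z p : (ziter (skew_homeo alpha h) z p).1 = p.1 + alpha *~ z.
Proof.
elim: z => [|n IH|n IH]; first by rewrite mulr0z addr0.
  by rewrite -addn1 PoszD ziterS mulrzDr mulr1z addrA -IH.
apply: (addIr alpha); rewrite -[RHS]addrA.
rewrite (_ : _ *~ _ + alpha = alpha *~ (- n.+1%:Z + 1)); last first.
  by rewrite mulrzDr mulr1z.
have e : - (n.+1)%:Z + 1 = - n%:Z by lia.
by rewrite e -IH -e ziterS.
Qed.

Lemma skew_ziter2S h z p : (ziter (skew_homeo alpha h) (z + 1) p).2 =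
  (ziter (skew_homeo alpha h) z p).2 + proj_circle (h (p.1 + alpha *~ z)).
Proof. by rewrite ziterS /= skew_ziter1. Qed.

(** Both second coordinates are sums of [`|z|] terms along the same orbit of the
    base rotation. *)
Lemma skew_ziter2_lipschitz h g (e : R) z p : (forall t, `|h t - g t| <= e) ->
  circle_norm ((ziter (skew_homeo alpha h) z p).2 -
               (ziter (skew_homeo alpha g) z p).2) <= e *+ `|z|%N.
Proof.
move=> hg.
pose D k :=
  (ziter (skew_homeo alpha h) k p).2 - (ziter (skew_homeo alpha g) k p).2.
have DS k : D (k + 1) =
    D k + proj_circle (h (p.1 + alpha *~ k) - g (p.1 + alpha *~ k)).
  by rewrite /D !skew_ziter2S opprD addrACA raddfB.
have small k : circle_norm (D (k + 1) - D k) <= e.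
  by rewrite DS addrC addKr (le_trans (circle_norm_le _)).
rewrite -/(D z); elim: z => [|n IH|n IH].
- by rewrite /D /= subrr circle_norm0.
- rewrite -[D _](subrK (D n)) mulrS (le_trans (circle_normD _ _))// lerD//.
  by rewrite -addn1 PoszD.
- rewrite -[D _](subrK (D (- n%:Z))) abszN mulrS.
  rewrite (le_trans (circle_normD _ _))//.
  rewrite abszN in IH; rewrite lerD// -circle_normN opprB.
  by rewrite (_ : - n%:Z = - (n.+1)%:Z + 1)//; lia.
Qed.

Lemma torus_mdist (p q : T * T) :
  mdist p q = Num.max (circle_norm (p.1 - q.1)) (circle_norm (p.2 - q.2)) :> R.
Proof. by []. Qed.

Lemma open_ziter_near z p (w : T * T) (e : R) :
  open [set h : C | mdist (ziter (skew_homeo alpha h) z p) w < e].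
Proof.
rewrite openE => h /= hw; apply/nbhs_uniform_norm.
pose d := e - mdist (ziter (skew_homeo alpha h) z p) w.
have d0 : 0 < d by rewrite subr_gt0.
exists (d / (`|z|%N.+1)%:R); first by rewrite divr_gt0.
move=> g hg /=.
apply: le_lt_trans (metric_triangle _ (ziter (skew_homeo alpha h) z p) _) _.
rewrite -ltrBrDr -/d metric_sym torus_mdist !skew_ziter1 subrr circle_norm0.
rewrite gt_max d0 /=.
apply: le_lt_trans (skew_ziter2_lipschitz _ _ (fun t => ltW (hg t))) _.
rewrite -[_ *+ `|z|%N]mulr_natr -mulrA gtr_pMr// mulrC ltr_pdivrMr//.
by rewrite mul1r ltr_nat.
Qed.

Lemma orbit_inj (x : T) :
  aperiodic alpha -> injective (fun z : int => x + alpha *~ z).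
Proof.
move=> alpha_inf i j /addrI /eqP; rewrite -subr_eq0 -mulrzBr => /eqP ij0.
apply/eqP.
rewrite -subr_eq0; apply: contraPT ij0 => ij; apply/eqP.
case: (i - j) ij => n; first by rewrite -lt0n; exact: alpha_inf.
by move=> _; rewrite NegzE mulrNz oppr_eq0; exact: alpha_inf.
Qed.

(** The second coordinates at the times [b m] can be prescribed.  The change
    needed between the times [b m] and [(b + 1) m] is defined mod 1, hence is
    represented by some [d b] in [[0, 1)], and it is spread evenly over the [m]
    intermediate points of the orbit. *)
Lemma steer h (m K : nat) (eta : R) (x y : T) (w : int -> T) :
  aperiodic alpha -> (0 < m)%N -> m%:R^-1 < eta -> w 0 = y ->
  exists2 g : C, (forall t, `|h t - g t| < eta) &
    forall b : int, (`|b| <= K)%N ->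
      (ziter (skew_homeo alpha g) (b * m%:Z) (x, y)).2 = w b.
Proof.
move=> alpha_inf m0 meta w0.
have mz : m%:R != 0 :> R by rewrite pnatr_eq0 -lt0n.
pose v k z := (ziter (skew_homeo alpha k) z (x, y)).2.
pose jump k b := v k ((b + 1) * m%:Z) - v k (b * m%:Z).
have [d dP] := choice (fun b : int =>
  circle_repr01 (w (b + 1) - w b - jump h b)).
pose c (i : int) : R := d (i %/ m%:Z)%Z / m%:R.
have cm i : `|c i| <= m%:R^-1.
  have [_ /andP[d0 d1]] := dP (i %/ m%:Z)%Z.
  by rewrite /c ger0_norm ?divr_ge0// ler_piMl ?invr_ge0// ltW.
(* The times in the blocks [[b m, (b + 1) m)] with [- K <= b < K]. *)
pose s : seq int := [seq k%:Z - (K * m)%N%:Z | k <- iota 0 (2 * K * m)].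
have m_ge0 : 0 <= m%:R^-1 :> R by rewrite invr_ge0.
have [p [cp pm pc]] :=
  bounded_interpolation s (orbit_inj (x := x) alpha_inf) m_ge0 cm.
have cg : continuous (fun t => h t + p t).
  have addC (X : topologicalType) (f1 f2 : X -> R) :
      continuous f1 -> continuous f2 -> continuous (fun t => f1 t + f2 t).
    by move=> c1 c2 t; apply: cvgD; [exact: c1|exact: c2].
  by apply: addC cp; exact: cts_fun.
pose g : C := mkcts cg.
exists g => [t|].
  by rewrite /g /mkcts opprD addNKr normrN (le_lt_trans (pm t)).
have block (b : int) (j : nat) : (- K%:Z <= b < K%:Z)%R -> (j <= m)%N ->
    v g (b * m%:Z + j%:Z) - v g (b * m%:Z) =
    v h (b * m%:Z + j%:Z) - v h (b * m%:Z) + proj_circle (d b / m%:R *+ j).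
  move=> bK; elim: j => [|j IH] jm.
    by rewrite addr0 !subrr mulr0n raddf0 addr0.
  rewrite -addn1 PoszD !addrA.
  rewrite /v !skew_ziter2S -!/(v _ _) addrAC IH ?(ltnW jm)//.
  have -> : g (x + alpha *~ (b * m%:Z + j%:Z)) =
      h (x + alpha *~ (b * m%:Z + j%:Z)) + d b / m%:R.
    rewrite /g /mkcts; congr (_ + _); rewrite pc /c.
      by rewrite divzMDl ?divz_small ?addr0//; lia.
    apply/mapP; exists (absz (b * m%:Z + j%:Z + (K * m)%N%:Z)); last by nia.
    by rewrite mem_iota; nia.
  rewrite addn1 mulrSr !(raddfD (@proj_circle R)) /= addrACA.
  by rewrite [X in X + _ = _]addrAC.
have jumpg (b : int) : (- K%:Z <= b < K%:Z)%R -> jump g b = w (b + 1) - w b.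
  move=> bK; rewrite /jump mulrDl mul1r block//.
  have := (dP b).1; rewrite /jump mulrDl mul1r.
  rewrite -mulr_natr divfK// => ->; rewrite addrC subrK; reflexivity.
have vg0 : v g (0 * m%:Z) = w 0 by rewrite mul0r w0.
elim => [//|n IH|n IH] nK.
  have vn : v g (n%:Z * m%:Z) = w n%:Z by apply: IH; lia.
  have jn : jump g n%:Z = w (n%:Z + 1) - w n%:Z by apply: jumpg; lia.
  by move: jn; rewrite /jump vn -PoszD addn1 => /addIr.
have vn : v g (- n%:Z * m%:Z) = w (- n%:Z) by apply: IH; lia.
have jn : jump g (- n.+1%:Z) = w (- n.+1%:Z + 1) - w (- n.+1%:Z).
  by apply: jumpg; lia.
move: jn; rewrite /jump (_ : - n.+1%:Z + 1 = - n%:Z); last lia.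
by rewrite vn => /addrI/oppr_inj.
Qed.

End skew_orbits.

(** * Genericity of simultaneous approximation *)

Section generic_cocycle.
Context {R : realType}.
Local Notation T := (circle R).
Local Notation C := (continuousType T R).
Variables (alpha x y : T).

Definition simultaneous_hits (N : nat) (k : int) (q : rat) (F : seq int)
    (e : R) : set C :=
  \bigcup_(m in [set m : nat | (0 < m)%N /\ (m = 1 %[mod N])%N])
    \bigcap_(f in [set` F])
      [set h : C | mdist (ziter (skew_homeo alpha h) (f * m%:Z) (x, y))
        (x + proj_circle (k%:~R / N%:R) *~ f, y + proj_circle (ratr q)) < e].

Lemma open_simultaneous_hits N k q F e : open (simultaneous_hits N k q F e).
Proof.
apply: bigcup_open => m _; rewrite bigcap_seq.
apply: big_ind; [exact: openT|exact: openI|] => f _.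
exact: open_ziter_near.
Qed.

(** Kronecker's theorem provides the time [m] and the first coordinates; a
    perturbation of size [1 / m] along the orbit adjusts the second ones.  At
    time 0 alone the orbit cannot be moved, whence [0 \notin F]. *)
Lemma dense_simultaneous_hits N k q F e :
  aperiodic alpha -> (0 < N)%N -> 0 \notin F -> 0 < e ->
  dense (simultaneous_hits N k q F e).
Proof.
move=> alpha_inf N0 F0 e0 O [h Oh] oO.
have /nbhs_uniform_norm[eta eta0 etaO] : nbhs h O by apply: open_nbhs_nbhs.
pose K := \max_(f <- F) absz f.
have FK f : f \in F -> (absz f <= K)%N by move=> fF; exact: leq_bigmax_seq.
(* The first coordinate at time [f m] has [`|f| <= K] times the error made on
   [m alpha], whence the precision [e / K.+1]; [m > 1 / eta] makes the
   perturbation small. *)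
have [m [mL m1 me]] := kronecker_congr N0 alpha_inf (proj_circle (k%:~R / N%:R))
  (Num.truncn eta^-1) (divr_gt0 e0 (ltr0Sn R K)).
have m0 : (0 < m)%N by exact: leq_trans mL.
have meta : m%:R^-1 < eta.
  rewrite invf_plt ?posrE ?ltr0n//.
  by rewrite (lt_le_trans (truncnS_gt _))// ler_nat.
pose w (b : int) := if b == 0 then y else y + proj_circle (ratr q).
have [g hg gw] := steer h K x (w := w) alpha_inf m0 meta erefl.
exists g; split; first exact: etaO.
exists m => // f /= fF; rewrite torus_mdist /= skew_ziter1 gw ?FK//=.
have /negbTE f0 : f != 0 by apply: contraNneq F0 => <-.
rewrite /w f0 subrr circle_norm0 gt_max e0 andbT.
have -> : x + alpha *~ (f * m%:Z) - (x + proj_circle (k%:~R / N%:R) *~ f) =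
    (alpha *+ m - proj_circle (k%:~R / N%:R)) *~ f.
  by rewrite opprD addrACA subrr add0r mulrzBl mulrC mulrzA.
apply: le_lt_trans (circle_normMz _ _) _.
apply: (@le_lt_trans _ _
    (circle_norm (alpha *+ m - proj_circle (k%:~R / N%:R)) *+ K)).
  by rewrite ler_wpMn2l ?circle_norm_ge0 ?FK.
move: me; rewrite ltr_pdivlMr ?ltr0Sn// -[_ *+ K]mulr_natr; apply: le_lt_trans.
by rewrite ler_wpM2l ?circle_norm_ge0// ler_nat.
Qed.

Definition steerable (h : C) := forall N k q (F : seq int) e,
  (0 < N)%N -> 0 \notin F -> 0 < e -> simultaneous_hits N k q F e h.

Lemma residual_steerable : aperiodic alpha -> residual steerable.
Proof.
move=> alpha_inf.
(* A countable family of data suffices: [e] is replaced by some [1 / (j + 1)]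
   below it, and removing 0 from the lists makes every member dense. *)
pose U (c : nat * int * rat * seq int * nat) : set C :=
  let: (N, k, q, F, j) := c in
  simultaneous_hits N.+1 k q [seq f <- F | f != 0] j.+1%:R^-1.
pose G i := if unpickle i is Some c then U c else setT.
have oG i : open (G i).
  rewrite /G; case: unpickle => [[[[[N k] q] F] j]|]; last exact: openT.
  exact: open_simultaneous_hits.
have dG i : dense (G i).
  rewrite /G; case: unpickle => [[[[[N k] q] F] j]|].
    by apply: dense_simultaneous_hits; rewrite ?mem_filter ?eqxx ?invr_gt0.
  by move=> O [h Oh] _; exists h.
exists (\bigcap_i G i); split; [by exists G|exact: baire_continuous|].
move=> h Gh N k q F e N0 F0 e0.
have je : (Num.truncn e^-1).+1%:R^-1 < e.
  by rewrite invf_plt ?posrE// truncnS_gt.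
have := Gh (pickle (N.-1, k, q, F, Num.truncn e^-1)) I.
rewrite /G pickleK /U prednK// (all_filterP _); last first.
  by apply/allP => f fF; apply: contraNneq F0 => <-.
move=> [m m1 mh]; exists m => // f fF; apply: lt_trans je.
exact: mh.
Qed.

(** Modulo 1, [f k / N] only depends on [f] mod [N]; the target is therefore the
    same for all [f] congruent to [n]. *)
Lemma steerable_congr h (N : nat) (n k l : int) (q : rat) (F : set int)
    (e : R) :
  steerable h -> (0 < N)%N -> (k * n = l %[mod N%:Z])%Z ->
  finite_set F -> (forall f, F f -> f != 0 /\ (f = n %[mod N%:Z])%Z) -> 0 < e ->
  exists m : nat, [/\ (0 < m)%N, (m = 1 %[mod N])%N & forall f, F f ->
    mdist (ziter (skew_homeo alpha h) (f * m%:Z) (x, y))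
      (x + proj_circle (l%:~R / N%:R), y + proj_circle (ratr q)) < e].
Proof.
move=> hh N0 knl /finite_seqP[s ->] Fn e0.
have s0 : 0 \notin s by apply/negP => /Fn[/eqP].
have [m [m0 m1] mh] := hh N k q s e N0 s0 e0.
exists m; split=> // f fs; have [_ fn] := Fn f fs.
suff <- : proj_circle (k%:~R / N%:R) *~ f = proj_circle (l%:~R / N%:R) :> T.
  exact: mh.
have /eqP : (k * f = l %[mod N%:Z])%Z by rewrite -modzMmr fn modzMmr.
rewrite eqz_mod_dvd => /dvdzP[c kf].
rewrite -raddfMz /=; apply/proj_circle_eq/intrP; exists c.
have NR : N%:R != 0 :> R by rewrite pnatr_eq0 -lt0n.
rewrite -mulrzr mulrAC -intrM -mulrBl -intrB kf intrM.
by rewrite mulfK.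
Qed.

End generic_cocycle.

(** * Approximation of a point of the torus by targets *)

Section approximation.
Context {R : realType}.
Local Notation T := (circle R).

Lemma circle_grid (u : T) (N : nat) : (0 < N)%N ->
  exists l : int, circle_norm (u - proj_circle (l%:~R / N%:R)) <= N%:R^-1.
Proof.
move=> N0; have [a <-] := proj_circle_surj u.
exists (Num.floor (a * N%:R)); rewrite -raddfB (le_trans (circle_norm_le _))//.
have NR : 0 < N%:R :> R by rewrite ltr0n.
rewrite -[leRHS]mul1r ler_pdivlMr// -[X in _ * X](ger0_norm (ltW NR)) -normrM.
rewrite mulrBl divfK ?gt_eqF// ler_norml.
have /andP[] := floor_itv (a * N%:R); rewrite intrD; lra.
Qed.

Lemma circle_rat (u : T) (e : R) : 0 < e ->
  exists q : rat, circle_norm (u - proj_circle (ratr q)) < e.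
Proof.
move=> e0; have [a <-] := proj_circle_surj u.
have /rat_in_itvoo[q] : a < a + e by rewrite ltrDl.
rewrite in_itv /= => /andP[aq qe]; exists q.
by rewrite -raddfB (le_lt_trans (circle_norm_le _))// ltr_norml; lra.
Qed.

Lemma torus_grid (p z : T * T) (N : nat) (e : R) : (0 < N)%N -> N%:R^-1 < e ->
  exists (l : int) (q : rat),
    mdist z (p.1 + proj_circle (l%:~R / N%:R), p.2 + proj_circle (ratr q)) < e.
Proof.
move=> N0 Ne; have e0 : 0 < e by rewrite (le_lt_trans _ Ne).
have [l le] := circle_grid (z.1 - p.1) N0.
have [q qe] := circle_rat (z.2 - p.2) e0.
exists l, q; rewrite torus_mdist /= gt_max !opprD !addrA qe andbT.
exact: le_lt_trans Ne.
Qed.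

End approximation.

(** * Dense simultaneous approximation and thick return times *)

Theorem theorem6p1 (R : realType) (alpha : circle R)
    (alpha_irrational : irrational_class alpha) (x y : circle R) :
  residual [set h : continuousType (circle R) R |
    dense_simultaneous_approximation (skew_homeo alpha h) (x, y) /\
    forall U : set (circle R * circle R), open U -> U !=set0 ->
      mult_thick_in_congruence_subsemigroup
        (return_times (skew_homeo alpha h) (x, y) U)].
Proof.
have [G [GG dG Gh]] :=
  residual_steerable x y (irrational_class_aperiodic alpha_irrational).
exists G; split=> // h /Gh hh {GG dG Gh G}.
have largeN (e : R) : 0 < e -> exists2 N : nat, (1 < N)%N & N%:R^-1 < e.
  move=> e0; exists (Num.truncn e^-1).+2 => //.
  by rewrite invf_plt ?posrE// (lt_trans (truncnS_gt _))// ltr_nat.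
split=> [delta delta0|U oU [z Uz]].
- have [N N1 Nd] := largeN _ delta0.
  have N0 := ltnW N1.
  exists N => // n nN z.
  have [l [q zlq]] := torus_grid (x, y) z N0 Nd.
  exists (x + proj_circle (l%:~R / N%:R), y + proj_circle (ratr q)) => //.
  move=> F finF FA e e0.
  have [[u v] /= uv] : exists uv : int * int, uv.1 * n + uv.2 * N%:Z = 1.
    by apply/coprimezP.
  (* [u] is an inverse of [n] mod [N], so [k = l u] steers the times congruent
     to [n] towards [l / N]. *)
  have kn : (l * u * n = l %[mod N%:Z])%Z.
    rewrite -mulrA (_ : u * n = 1 - v * N%:Z); last by rewrite -uv addrK.
    by rewrite mulrBr mulr1 mulrA -mulNr addrC modzMDl.
  have [|m [m0 _ mF]] := steerable_congr q hh N0 kn finF _ e0; last by exists m.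
  move=> f /FA[c _ <-]; split; last by rewrite mulrC modzMDl.
  (* [f = 0] would make [N > 1] divide the coprime integer [n]. *)
  apply/eqP => c0.
  have : (N%:Z %| 1)%Z.
    apply/dvdzP; exists (v - u * c); apply: (etrans (esym uv)).
    have -> : n = - (N%:Z * c) by apply/eqP; rewrite -addr_eq0 addrC c0.
    by ring.
  by rewrite dvdz1 absz_nat => /eqP N1'; rewrite N1' in N1.
- have /(@nbhs_ballP R)[r /= r0 rU] : nbhs z U by apply: open_nbhs_nbhs.
  have [N N1 Nr] := largeN _ r0.
  have N0 := ltnW N1.
  have [l [q zlq]] := torus_grid (x, y) z N0 Nr.
  exists N => // F finF FA.
  pose w := (x + proj_circle (l%:~R / N%:R), y + proj_circle (ratr q)).
  have d0 : 0 < r - mdist z w by rewrite subr_gt0.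
  have l1 : (l * 1 = l %[mod N%:Z])%Z by rewrite mulr1.
  have [m [m0 m1 mF]] := steerable_congr q hh N0 l1 finF FA d0.
  exists m%:Z; first by split; [case: m m0 {m1 mF}|rewrite !modz_nat m1].
  move=> _ [f Ff <-]; apply: rU; rewrite ballEmdist /= mulrC.
  apply: le_lt_trans (metric_triangle _ w _) _.
  by rewrite -ltrBrDl metric_sym; exact: mF.
Qed.
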